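(* Let $n\geq 3$ and let $\mathcal{K}_n$ be a weighted oriented complete graph on the vertices $x_1,\ldots,x_n$. Let $R=k[x_1,\ldots,x_n]$. If $x_n$ is a sink in $\mathcal{K}_n$, then $$\beta_{i,j}(R/I(\mathcal{K}_n))=\begin{cases}\beta_{i,j}(R/I(\mathcal{K}_{n-1}))+\binom{n-1}{i}+\beta_{i-1,j-w_n}(R/I(\mathcal{K}_{n-1})) & \text{if } j=i+w_n,\\[4pt] \beta_{i,j}(R/I(\mathcal{K}_{n-1}))+\beta_{i-1,j-w_n}(R/I(\mathcal{K}_{n-1})) & \text{if } j\neq i+w_n\end{cases}$$ for all $i>1$, where $\mathcal{K}_{n-1}$ denotes the induced weighted oriented complete graph $\mathcal{K}_n\setminus x_n$ on $x_1,\ldots,x_{n-1}$.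
   Context: A weighted oriented graph $\mathcal{D}$ is a finite simple graph in which each edge is given exactly one orientation, together with a function $w:V(\mathcal{D})\to\mathbb{N}^+$; write $w_i=w(x_i)$ and $(x,y)$ for an edge oriented from $x$ to $y$. By convention source vertices (vertices having only outgoing edges) of the given graph have weight $1$; their weights do not affect the edge ideal. A sink is a vertex having only incoming edges. With $k$ a field and $R=k[x_1,\ldots,x_n]$, the edge ideal is $I(\mathcal{D})=(x_ix_j^{w_j} : (x_i,x_j)\in E(\mathcal{D}))$. $\mathcal{K}_n$ denotes a weighted oriented graph whose underlying graph is the complete graph on $\{x_1,\ldots,x_n\}$ (any orientation), considered for more than one vertex, and it is assumed that at least one vertex $x_p$ of $\mathcal{K}_n$ has $w_p>1$. The graph $\mathcal{K}_{n-1}=\mathcal{K}_n\setminus x_n$ is obtained by deleting $x_n$, keeping orientations and weights of the remaining vertices; $I(\mathcal{K}_{n-1})$ is regarded as an ideal of $R$. $\beta_{i,j}$ denotes graded Betti numbers over $R$. *)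

(* Defs.v *)
From HB Require Import structures.
From mathcomp Require Import all_boot all_order all_algebra.
From mathcomp Require Import mpoly.
From Stdlib Require Import ClassicalEpsilon.

Set Implicit Arguments.
Unset Strict Implicit.
Unset Printing Implicit Defensive.

Import Order.TTheory GRing.Theory Num.Theory.
Local Open Scope ring_scope.

(* The vertex set is a subset of the n variables, so that a graph obtained by
   deleting vertices still has its edge ideal in the same polynomial ring. *)
Record wograph (n : nat) := Wograph {
  vset : {set 'I_n};
  arc : rel 'I_n;
  wt : 'I_n -> nat;
  arc_vset : forall x y, arc x y -> (x \in vset) && (y \in vset);
  arc_oriented : forall x y, arc x y -> ~~ arc y x;
  wt_gt0 : forall x, x \in vset -> (0 < wt x)%N
}.

Section Graphs.
Variable n : nat.
Implicit Type D : wograph n.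

Definition is_source D (x : 'I_n) :=
  x \in vset D /\ forall y, ~~ arc D y x.

Definition is_sink D (x : 'I_n) :=
  x \in vset D /\ forall y, ~~ arc D x y.

Definition is_complete D :=
  forall x y, x \in vset D -> y \in vset D -> x != y -> arc D x y || arc D y x.

Definition del_arc D (v : 'I_n) : rel 'I_n :=
  [rel x y | [&& arc D x y, x != v & y != v]].

Lemma del_arc_vset D v x y :
  del_arc D v x y -> (x \in vset D :\ v) && (y \in vset D :\ v).
Proof.
case/and3P=> /arc_vset/andP[xD yD] xv yv.
by rewrite !inE xv xD yv yD.
Qed.

Lemma del_arc_oriented D v x y : del_arc D v x y -> ~~ del_arc D v y x.
Proof. by case/and3P=> /arc_oriented/negbTE h _ _; rewrite /del_arc /= h. Qed.

Lemma del_wt_gt0 D v x : x \in vset D :\ v -> (0 < wt D x)%N.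
Proof. by case/setD1P=> _; exact: wt_gt0. Qed.

Definition del_vertex D v : wograph n :=
  Wograph (@del_arc_vset D v) (@del_arc_oriented D v) (@del_wt_gt0 D v).

Definition edge_ideal (k : fieldType) D (p : {mpoly k[n]}) : Prop :=
  exists c : 'I_n * 'I_n -> {mpoly k[n]},
    p = \sum_(e | arc D e.1 e.2) c e * ('X_(e.1) * 'X_(e.2) ^+ wt D e.2).

End Graphs.

Arguments edge_ideal {n} k D p.

Section Betti.
Variables (n : nat) (k : fieldType).
Local Notation R := {mpoly k[n]}.

Definition homogz (d : int) (p : R) : Prop :=
  match d with
  | Posz m => p \is m.-homog
  | Negz _ => p = 0
  end.

(* F_i is free of rank [rk i], its a-th basis vector having degree [deg i a],
   that is, F_i = \bigoplus_a R(- deg i a).  Elements of F_i are row vectors;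
   F_{i+1} -> F_i is v |-> v *m dif i, and F_0 -> R/I sends v to the class of
   v *m aug. *)
Record free_cplx := FreeCplx {
  rk : nat -> nat;
  deg : forall i, 'I_(rk i) -> int;
  aug : 'cV[R]_(rk 0%N);
  dif : forall i, 'M[R]_(rk i.+1, rk i)
}.

Arguments deg : clear implicits.

Record min_graded_free_res (I : R -> Prop) (F : free_cplx) : Prop := {
  res_aug_homog : forall a, homogz (deg F 0%N a) (aug F a 0);
  res_dif_homog : forall i a b,
    homogz (deg F i.+1 a - deg F i b) (dif F i a b);
  res_aug_surj : forall p : R,
    exists v : 'rV[R]_(rk F 0%N), I (p - (v *m aug F) 0 0);
  res_exact0 : forall v : 'rV[R]_(rk F 0%N),
    I ((v *m aug F) 0 0) <-> exists u, v = u *m dif F 0%N;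
  res_exactS : forall i (v : 'rV[R]_(rk F i.+1)),
    v *m dif F i = 0 <-> exists u, v = u *m dif F i.+1;
  (* entries lie in the maximal ideal ('X_0, ..., 'X_(n-1)) *)
  res_minimal : forall i a b, (dif F i a b)@_0%MM = 0
}.

(* beta_{i,j}(R/I): the number of summands R(-j) in step i of a minimal graded
   free resolution of R/I.  Such a resolution exists for every homogeneous I
   and is unique up to isomorphism, so the chosen number does not depend on the
   choice.  The internal degree j is an integer: it may be negative after a
   shift. *)
Definition betti (I : R -> Prop) (i : nat) (j : int) : nat :=
  epsilon (inhabits 0%N) (fun b =>
    exists F, min_graded_free_res I F /\ b = #|[set a | deg F i a == j]|).

End Betti.

Arguments deg {n k} f i _.

(* Main.v *)
From HB Require Import structures.
Require Import Defs.
From mathcomp Require Import all_boot all_order all_algebra.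
From mathcomp Require Import mpoly.
From mathcomp Require Import zify.
From Stdlib Require Import Classical ClassicalEpsilon.

(** Let [y] be the sink, [w] its weight, [S] the ideal generated by the other
    variables, [J] the edge ideal of the graph without [y], and [I] the edge
    ideal of the whole graph. By completeness, [y] is the head of an edge from
    every other vertex, and as a sink it is the tail of none, so
    [I = J + y ^ w S] ([edge_ideal_sink]). No generator of [J] involves [y], so
    [y ^ w] is regular modulo [J]; since [J] lies in [S], multiplication by
    [y ^ w] embeds [S/J] into [R/J], with cokernel [R/I].

    Let [F] be the minimal graded free resolution of [R/J] and [K] the Koszul
    complex on the variables other than [y]. A lift [F -> K] of the projection
    [R/J -> R/S] restricts, past degree 0, to a lift of the inclusion [J -> S],
    and the cone [C] of this restriction resolves [S/J]. The cone of a lift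
    [C(-w) -> F] of multiplication by [y ^ w] is then a resolution of [R/I],
    whose term in step [i > 1] is the sum of [F_i], [K_i(-w)] and
    [F_(i-1)(-w)]. It is minimal: the lift [C(-w) -> F] has entries divisible
    by [y ^ w], and the lift [F -> K] is zero modulo the variables in positive
    steps for degree reasons, as the basis of [K_i] lives in degree [i] whereas
    that of [F_i] lives in degrees greater than [i], [J] being generated in
    degrees at least 2. Counting basis vectors of degree [j] gives the formula
    ([splitting_res]).

    This uses that Betti numbers may be read off any minimal graded free
    resolution of a homogeneous ideal ([bettiE]), and that one exists
    ([min_res_exists]). For the first fact, degree-preserving lifts of the
    identity of [R/I] between two minimal resolutions are mutually inverse
    modulo the variables, because the homotopies vanish there. For the second,
    submodules of free modules are finitely generated ([submodule_fg], by
    Dickson's lemma), and a system of homogeneous generators with as few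
    elements as possible has no relation with a unit coefficient
    ([min_hom_generators]); applying this to successive kernels builds the
    resolution. *)

Set Implicit Arguments.
Unset Strict Implicit.
Unset Printing Implicit Defensive.

Import Order.TTheory GRing.Theory Num.Theory.
Local Open Scope ring_scope.

(** * Finite generation of submodules of free modules *)

(** Dickson's lemma, restricted to the first [c] exponents so that it can be
    proved by induction on [c]. *)
Lemma dickson_upto n (c : nat) (P : 'X_{1..n} -> Prop) :
  exists s : seq 'X_{1..n}, (forall m, m \in s -> P m) /\
    forall m, P m ->
      exists2 m', m' \in s & forall i : 'I_n, (i < c)%N -> (m' i <= m i)%N.
Proof.
elim: c P => [|c IH] P.
  have [[m Pm]|nP] := classic (exists m, P m); last first.
    by exists [::]; split => // m Pm; case: nP; exists m.
  exists [:: m]; split=> [m'|m' _]; first by rewrite inE => /eqP ->.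
  by exists m; rewrite ?inE.
have [c_lt|c_ge] := ltnP c n; last first.
  have [s [sP sD]] := IH P; exists s; split=> // m /sD[m' m's le_m'].
  by exists m' => // i _; apply: le_m'; apply: leq_trans (ltn_ord i) c_ge.
pose z := Ordinal c_lt.
have bounded N : exists s : seq 'X_{1..n}, (forall m, m \in s -> P m) /\
    forall m, P m -> (m z < N)%N ->
      exists2 m', m' \in s & forall i : 'I_n, (i < c.+1)%N -> (m' i <= m i)%N.
  elim: N => [|N [s [sP sD]]]; first by exists [::].
  have [t [tP tD]] := IH (fun m => P m /\ m z = N).
  exists (s ++ t); split=> [m|m Pm].
    by rewrite mem_cat => /orP[/sP|/tP[]].
  rewrite ltnS leq_eqVlt => /orP[/eqP mN|m_lt]; last first.
    by have [m' m's h] := sD m Pm m_lt; exists m'; rewrite // mem_cat m's.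
  have [m' m't h] := tD m (conj Pm mN).
  exists m'; rewrite ?mem_cat ?m't ?orbT // => i; rewrite ltnS leq_eqVlt.
  case/orP=> [/eqP ic|/h //]; rewrite (_ : i = z); last exact: val_inj.
  by have [_ ->] := tP _ m't; rewrite mN.
have [s [sP sD]] := IH P.
have [t [tP tD]] := bounded (\max_(m <- s) m z)%N.
exists (s ++ t); split=> [m|m Pm].
  by rewrite mem_cat => /orP[/sP|/tP].
have [m_lt|m_ge] := ltnP (m z) (\max_(m <- s) m z)%N.
  by have [m' m't h] := tD m Pm m_lt; exists m'; rewrite // mem_cat m't orbT.
have [m' m's h] := sD m Pm; exists m'; rewrite ?mem_cat ?m's // => i.
rewrite ltnS leq_eqVlt => /orP[/eqP ic|/h //].
rewrite (_ : i = z); last exact: val_inj.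
apply: leq_trans m_ge.
exact: (@leq_bigmax_seq _ _ xpredT (fun m : 'X_{1..n} => m z) _ m's isT).
Qed.

Lemma dickson n (P : 'X_{1..n} -> Prop) :
  exists s : seq 'X_{1..n}, (forall m, m \in s -> P m) /\
    forall m, P m -> exists2 m', m' \in s & (m' <= m)%MM.
Proof.
have [s [sP sD]] := dickson_upto n P; exists s; split=> // m /sD[m' m's h].
by exists m' => //; apply/mnm_lepP => i; apply: h.
Qed.

Section Noetherian.
Variables (n : nat) (k : fieldType).
Local Notation R := {mpoly k[n]}.

(** The row vectors [v] that lie in the submodule generated by the rows
    of [B]. *)
Definition rowspan r q (B : 'M[R]_(r, q)) (v : 'rV[R]_q) :=
  exists u, v = u *m B.

(** Linear combinations [u + c *: v] cover both sums and multiples. *)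
Definition submodule q (N : 'rV[R]_q -> Prop) :=
  N 0 /\ forall c u v, N u -> N v -> N (u + c *: v).

Lemma submodule_mul q (N : 'rV[R]_q -> Prop) r (B : 'M_(r, q)) u :
  submodule N -> (forall a, N (row a B)) -> N (u *m B).
Proof.
case=> N0 ND BN; rewrite mulmx_sum_row.
apply: (big_ind (fun v => N v)) => //.
  by move=> x y Nx Ny; rewrite -[y]scale1r; apply: ND.
by move=> i _; rewrite -[_ *: _]add0r; apply: ND.
Qed.

Lemma rowspan_submodule r q (B : 'M_(r, q)) : submodule (rowspan B).
Proof.
split; first by exists 0; rewrite mul0mx.
by move=> c _ _ [u ->] [v ->]; exists (u + c *: v); rewrite mulmxDl -scalemxAl.
Qed.

Lemma rowspan_row r q (B : 'M_(r, q)) a : rowspan B (row a B).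
Proof. by exists (delta_mx 0 a); rewrite rowE. Qed.

(** Division by a finite set of elements of the ideal whose leading monomials
    generate all leading monomials of the ideal. *)
Lemma ideal_fg (N : 'rV[R]_1 -> Prop) : submodule N ->
  exists r (B : 'M[R]_(r, 1)), (forall a, N (row a B)) /\
    forall v, N v -> rowspan B v.
Proof.
move=> [N0 ND].
pose LM (m : 'X_{1..n}) := exists p : R, [/\ N p%:M, p != 0 & mlead p = m].
have [s [sP sD]] := dickson LM.
pose lift m := epsilon (inhabits (0 : R))
                 (fun p => [/\ N p%:M, p != 0 & mlead p = m]).
have liftP m : m \in s -> [/\ N (lift m)%:M, lift m != 0 & mlead (lift m) = m].
  by move/sP => h; apply: (epsilon_spec (inhabits (0 : R)) _ h).
pose B : 'M[R]_(size s, 1) := \matrix_(a, _) lift (nth 0%MM s a).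
have rowB a : row a B = (lift (nth 0%MM s a))%:M.
  by apply/rowP => b; rewrite !mxE ord1 eqxx mulr1n.
exists (size s), B; split=> [a|v].
  by rewrite rowB; have [] := liftP _ (mem_nth 0%MM (ltn_ord a)).
rewrite [v]mx11_scalar; move: (v 0 0) => {v} p.
have [spB0 spBD] := rowspan_submodule B.
move: {-2}(mlead p) (erefl (mlead p)) => M.
elim/(well_founded_ind (@ltom_wf n)): M p => M IH p pM Np.
have [->|p0] := eqVneq p 0.
  by rewrite (_ : 0%:M = 0) // raddf0.
have [m' m's lem] := sD (mlead p) (ex_intro _ p (And3 Np p0 erefl)).
have [Nl l0 lml] := liftP _ m's.
(* Subtracting c times a generator cancels the leading term of p. *)
pose c : R := (mleadc p / mleadc (lift m')) *: 'X_[(mlead p - m')%MM].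
pose q := p - c * lift m'.
have im' : (index m' s < size s)%N by rewrite index_mem.
have spl : rowspan B (lift m')%:M.
  have := rowspan_row B (Ordinal im'); rewrite rowB /=.
  by rewrite nth_index.
have -> : p%:M = q%:M + c *: (lift m')%:M :> 'rV[R]_1.
  by apply/rowP => b; rewrite !mxE ord1 /q /= !mulr1n subrK.
apply: spBD => //.
have Nq : N q%:M.
  have -> : q%:M = p%:M + (- c) *: (lift m')%:M :> 'rV[R]_1.
    by apply/rowP => b; rewrite !mxE ord1 /q /= !mulr1n mulNr.
  exact: ND.
have [q0|q0] := eqVneq q 0; first by rewrite q0 raddf0.
have ldl : mleadc (lift m') != 0 by rewrite mleadc_eq0.
have ldp : mleadc p != 0 by rewrite mleadc_eq0.
have cl0 : mleadc p / mleadc (lift m') != 0 by rewrite mulf_neq0 ?invr_eq0.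
have c0 : c != 0 by rewrite -msupp_eq0 msuppMCX.
have mc : mlead (c * lift m') = mlead p.
  by rewrite mleadM // mleadZ // mleadXm lml submK.
have lcc : mleadc (c * lift m') = mleadc p.
  by rewrite mleadM // mleadcM mleadcZE mleadXm mcoeffX eqxx mulr1 divfK.
have lt_q : (mlead q < mlead p)%O.
  rewrite lt_neqAle; apply/andP; split.
    apply: contra_neq q0 => e; apply/eqP; rewrite -mleadc_eq0 e /q mcoeffB.
    by rewrite -{2}mc lcc subrr.
  apply: le_trans (mleadB_le _ _) _; rewrite mc.
  by rewrite joinxx.
by apply: (IH (mlead q)); rewrite // pM.
Qed.

Lemma submodule_fg q (N : 'rV[R]_q -> Prop) : submodule N ->
  exists r (B : 'M[R]_(r, q)), (forall a, N (row a B)) /\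
    forall v, N v -> rowspan B v.
Proof.
elim: q N => [|q IH]; last rewrite -[q.+1]/(1 + q)%N; move=> N subN.
  exists 0%N, 0; split=> [[]//|v _]; exists 0; rewrite mul0mx.
  exact: thinmx0.
have [N0 ND] := subN.
(* L is the ideal of first coordinates of elements of N, and N' below is the
   submodule of the elements whose first coordinate is zero. *)
pose L (w : 'rV[R]_1) := exists2 v : 'rV[R]_(1 + q), N v & lsubmx v = w.
have subL : submodule L.
  split; first by exists 0 => //; rewrite linear0.
  move=> c _ _ [u Nu <-] [v Nv <-]; exists (u + c *: v); first exact: ND.
  by rewrite linearD linearZ.
have [r1 [B1 [B1L LB1]]] := ideal_fg subL.
have [A1 A1N] : exists A1 : 'M[R]_(r1, 1 + q),
    (forall a, N (row a A1)) /\ lsubmx A1 = B1.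
  have [f fN fP] := fin_all_exists2 B1L.
  exists (\matrix_a f a); split=> [a|]; first by rewrite rowK.
  apply/row_matrixP => a; rewrite -fP.
  by apply/rowP=> b; rewrite !mxE.
pose N' (w : 'rV[R]_q) := N (row_mx (0 : 'rV_1) w).
have subN' : submodule N'.
  split; rewrite /N'; first by rewrite row_mx0.
  move=> c u v Nu Nv.
  have -> : row_mx (0 : 'rV_1) (u + c *: v) = row_mx 0 u + c *: row_mx 0 v.
    by rewrite scale_row_mx add_row_mx scaler0 addr0.
  exact: ND.
have [r2 [B2 [B2N NB2]]] := IH _ subN'.
exists (r1 + r2)%N, (col_mx A1 (row_mx 0 B2)); split=> [a|v Nv].
  case: (splitP a) => b ab.
    have -> : a = lshift r2 b by apply: val_inj.
    by rewrite rowKu; apply: A1N.1.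
  have -> : a = rshift r1 b by apply: val_inj.
  by rewrite rowKd row_row_mx linear0; apply: B2N.
have [u1 u1P] := LB1 _ (ex_intro2 _ _ v Nv erefl).
pose v' : 'rV[R]_(1 + q) := v - u1 *m A1.
have Nv' : N v'.
  by rewrite /v' -scaleN1r; apply: ND => //; apply: submodule_mul A1N.1.
have lv' : lsubmx v' = 0.
  by rewrite /v' linearB /= -mulmx_lsub A1N.2 u1P subrr.
have [u2 u2P] : rowspan B2 (rsubmx v').
  by apply: NB2; rewrite /N' -lv' hsubmxK.
exists (row_mx u1 u2); rewrite mul_row_col mul_mx_row mulmx0 -u2P -lv' hsubmxK.
by rewrite addrC subrK.
Qed.

End Noetherian.

(** * Homogeneous components *)

Section Grading.
Variables (n : nat) (k : fieldType).
Local Notation R := {mpoly k[n]}.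

(** The homogeneous component of [p] of degree [d], which is [0] for
    negative [d]. *)
Definition hcomp (d : int) (p : R) : R :=
  match d with
  | Posz m => pihomog mdeg m p
  | Negz _ => 0
  end.

Lemma mcoeff_pihomog d (p : R) m :
  (pihomog mdeg d p)@_m = if mdeg m == d then p@_m else 0.
Proof.
rewrite pihomogE raddf_sum /= (eq_bigr (fun m' => p@_m' * (m' == m)%:R)).
  case: ifP => [dm|dm].
    have [ms|ms] := boolP (m \in msupp p).
      rewrite big_mkcond (bigD1_seq m) ?msupp_uniq //= dm eqxx mulr1.
      by rewrite big1 ?addr0 // => m' /negPf ->; rewrite mulr0 if_same.
    rewrite (memN_msupp_eq0 ms) big_seq_cond big1 // => m' /andP[ms' _].
    by case: eqP ms' => [->|_ _]; rewrite ?mulr0 // (negPf ms).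
  rewrite big1 // => m' dm'; case: eqP => [e|]; rewrite ?mulr0 //.
  by rewrite -e dm' in dm.
by move=> m' _; rewrite mcoeffZ mcoeffX.
Qed.

Lemma mcoeff_hcomp d (p : R) m :
  (hcomp d p)@_m = if (mdeg m)%:Z == d then p@_m else 0.
Proof. by case: d => d /=; rewrite ?mcoeff0 // mcoeff_pihomog eqz_nat. Qed.

Lemma homogzP d (p : R) :
  homogz d p <-> forall m, p@_m != 0 -> (mdeg m)%:Z = d.
Proof.
case: d => d /=; split.
- by move/dhomogP => h m; rewrite -mcoeff_msupp => /h ->.
- by move=> h; apply/dhomogP => m; rewrite mcoeff_msupp => /h [].
- by move=> -> m; rewrite mcoeff0 eqxx.
- by move=> h; apply/mpolyP => m; rewrite mcoeff0; apply/eqP/negPn/negP=> /h.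
Qed.

Lemma hcomp_homogz d (p : R) : homogz d (hcomp d p).
Proof.
apply/homogzP => m; rewrite mcoeff_hcomp.
by case: ifP => [/eqP|]; rewrite ?eqxx.
Qed.

Lemma hcomp_id d (p : R) : homogz d p -> hcomp d p = p.
Proof.
move/homogzP => h; apply/mpolyP => m; rewrite mcoeff_hcomp.
by case: ifP => // /eqP m_d; apply/esym/eqP/negPn/negP => /h.
Qed.

Lemma hcompM d e (p g : R) :
  homogz e g -> hcomp d (p * g) = hcomp (d - e) p * g.
Proof.
move/homogzP => h; apply/mpolyP => m; rewrite mcoeff_hcomp !mcoeffM.
rewrite [if _ then _ else _](_ : _ =
  \sum_(k : 'X_{1..n < (mdeg m).+1, (mdeg m).+1} | m == (k.1 + k.2)%MM)
    if (mdeg m)%:Z == d then p@_k.1 * g@_k.2 else 0); last first.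
  by case: ifP; rewrite // big1.
apply: eq_bigr => -[m1 m2] /= /eqP em; rewrite mcoeff_hcomp.
have [->|/h g2] := eqVneq g@_m2 0; first by rewrite !mulr0; case: ifP.
have -> : (mdeg m)%:Z = (mdeg m1)%:Z + e by rewrite [in LHS]em mdegD PoszD g2.
rewrite -[d in _ == d](subrK e) (can_eq (addrK e)).
by case: ifP; rewrite ?mul0r.
Qed.

Lemma hcomp_is_linear d : linear (hcomp d).
Proof.
move=> c p q; apply/mpolyP => m.
rewrite !(mcoeffD, mcoeffZ, mcoeff_hcomp).
by case: ifP; rewrite // mulr0 addr0.
Qed.

HB.instance Definition _ d :=
  GRing.isLinear.Build k R R _ (hcomp d) (hcomp_is_linear d).

Lemma hcomp0E (p : R) : hcomp 0 p = (p@_0%MM)%:MP.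
Proof.
apply/mpolyP => m; rewrite mcoeff_hcomp mcoeffC eqz_nat mdeg_eq0.
by case: eqP => [->|]; rewrite ?mulr1 ?mulr0.
Qed.

Lemma homogz_mul d e (p q : R) :
  homogz d p -> homogz e q -> homogz (d + e) (p * q).
Proof.
move=> hp hq; rewrite -(hcomp_id hp) -[d in hcomp d](addrK e) -hcompM //.
exact: hcomp_homogz.
Qed.

Lemma homogz0 d : homogz d (0 : R).
Proof. by apply/homogzP => m; rewrite mcoeff0 eqxx. Qed.

Lemma homogzN d (p : R) : homogz d p -> homogz d (- p).
Proof.
by move=> hp; rewrite -(hcomp_id hp) -linearN; apply: hcomp_homogz.
Qed.

Lemma homogz1 : homogz 0 (1 : R).
Proof. exact: dhomog1. Qed.

Lemma homogz_sign d i (p : R) : homogz d p -> homogz d ((-1) ^+ i * p).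
Proof.
move=> hp; rewrite -signr_odd; case: odd; rewrite ?mulN1r ?mul1r //.
exact: homogzN.
Qed.

Lemma homogz_cst0 d (p : R) : homogz d p -> d != 0 -> p@_0%MM = 0.
Proof.
by move/homogzP => h d0; apply: contraNeq d0 => /h <-; rewrite mdeg0.
Qed.

(** A matrix is homogeneous for degrees [dr] of the rows and [dc] of the
    columns when it is a degree-preserving map between the graded free modules
    with basis vectors of these degrees. *)
Definition hom_mx p q (dr : 'I_p -> int) (dc : 'I_q -> int)
    (A : 'M[R]_(p, q)) :=
  forall a b, homogz (dr a - dc b) (A a b).

(** The degree-preserving component of a matrix. *)
Definition mxcomp p q (dr : 'I_p -> int) (dc : 'I_q -> int)
    (A : 'M[R]_(p, q)) :=
  \matrix_(a, b) hcomp (dr a - dc b) (A a b).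

Lemma mxcomp_hom p q (dr : 'I_p -> int) (dc : 'I_q -> int) A :
  hom_mx dr dc (mxcomp dr dc A).
Proof. by move=> a b; rewrite mxE; apply: hcomp_homogz. Qed.

Lemma mxcomp_id p q (dr : 'I_p -> int) (dc : 'I_q -> int) A :
  hom_mx dr dc A -> mxcomp dr dc A = A.
Proof. by move=> h; apply/matrixP => a b; rewrite mxE hcomp_id. Qed.

Lemma mxcompM p q r (dr : 'I_p -> int) (dm : 'I_q -> int) (dc : 'I_r -> int)
    (A : 'M_(p, q)) (B : 'M_(q, r)) :
  hom_mx dm dc B -> mxcomp dr dc (A *m B) = mxcomp dr dm A *m B.
Proof.
move=> hB; apply/matrixP => a b; rewrite !mxE linear_sum /=.
apply: eq_bigr => c _.
by rewrite !mxE (hcompM _ _ (hB c b)); congr (hcomp _ _ * _); lia.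
Qed.

Lemma hom_mx_mul p q r (dr : 'I_p -> int) (dm : 'I_q -> int) (dc : 'I_r -> int)
    (A : 'M_(p, q)) (B : 'M_(q, r)) :
  hom_mx dr dm A -> hom_mx dm dc B -> hom_mx dr dc (A *m B).
Proof.
by move=> hA hB; rewrite -(mxcomp_id hA) -(mxcompM _ _ hB); apply: mxcomp_hom.
Qed.

(** A homogeneous family in the row span of a homogeneous matrix has
    homogeneous coordinates. *)
Lemma hom_mx_lift p q r (dr : 'I_p -> int) (dm : 'I_q -> int)
    (dc : 'I_r -> int) (A : 'M_(p, r)) (B : 'M_(q, r)) :
  hom_mx dr dc A -> hom_mx dm dc B -> (forall a, rowspan B (row a A)) ->
  exists2 U : 'M_(p, q), hom_mx dr dm U & A = U *m B.
Proof.
move=> hA hB sp; have [f fP] := fin_all_exists sp.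
exists (mxcomp dr dm (\matrix_a f a)); first exact: mxcomp_hom.
rewrite -(mxcompM _ _ hB) [_ *m B](_ : _ = A) ?mxcomp_id //.
by apply/row_matrixP => a; rewrite row_mul rowK fP.
Qed.

(** The reduction of a matrix modulo the ideal generated by the variables. *)
Definition cst p q (A : 'M[R]_(p, q)) : 'M[k]_(p, q) := map_mx (mcoeff 0%MM) A.

Lemma cstM p q r (A : 'M_(p, q)) (B : 'M_(q, r)) :
  cst (A *m B) = cst A *m cst B.
Proof. exact: map_mxM. Qed.

Lemma cst_row p q (A : 'M_(p, q)) a : cst (row a A) = row a (cst A).
Proof. exact: map_row. Qed.

Lemma cst0P p q (A : 'M[R]_(p, q)) :
  cst A = 0 <-> forall a b, (A a b)@_0%MM = 0.
Proof.
split=> [h a b|h]; last by apply/matrixP => a b; rewrite !mxE.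
by move/matrixP/(_ a b): h; rewrite !mxE.
Qed.

(** ** Minimal systems of homogeneous generators *)

Lemma sum_mxcomp q (dc : 'I_q -> int) (v : 'rV_q) :
  exists D : seq int, v = \sum_(d <- D) mxcomp (fun=> d) dc v.
Proof.
(* The degrees of all terms of v. *)
pose D := undup (flatten [seq [seq (mdeg m)%:Z + dc b | m <- msupp (v 0 b)]
                         | b <- enum 'I_q]).
exists D; apply/rowP => b; apply/mpolyP => m; rewrite summxE raddf_sum /=.
under eq_bigr => d _ do rewrite mxE mcoeff_hcomp.
have [v0|vN0] := eqVneq (v 0 b)@_m 0.
  by rewrite v0 big1 // => d _; case: ifP.
rewrite (bigD1_seq ((mdeg m)%:Z + dc b)) ?undup_uniq //=; last first.
  rewrite mem_undup; apply/flatten_mapP; exists b; first exact: mem_enum.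
  by apply/mapP; exists m; rewrite ?mcoeff_msupp.
rewrite addrK eqxx big1 ?addr0 // => d /eqP nd.
by case: ifP => // /eqP e; case: nd; rewrite e subrK.
Qed.

Lemma hom_generators q (dc : 'I_q -> int) (N : 'rV[R]_q -> Prop) :
  submodule N -> (forall d v, N v -> N (mxcomp (fun=> d) dc v)) ->
  exists r (dr : 'I_r -> int) (B : 'M_(r, q)), [/\ hom_mx dr dc B,
    forall a, N (row a B) & forall v, N v -> rowspan B v].
Proof.
move=> subN gradN; have [r0 [B0 [B0N NB0]]] := submodule_fg subN.
have [D DP] := fin_all_exists (fun a => sum_mxcomp dc (row a B0)).
pose s := flatten [seq [seq (d, a) | d <- D a] | a <- enum 'I_r0].
pose x (a : 'I_(size s)) := tnth (in_tuple s) a.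
pose B := \matrix_a mxcomp (fun=> (x a).1) dc (row (x a).2 B0).
exists (size s), (fun a => (x a).1), B; split=> [a b|a|v /NB0[u ->]].
- have := @mxcomp_hom _ _ (fun=> (x a).1) dc (row (x a).2 B0) 0 b.
  by rewrite !mxE.
- by rewrite rowK; apply/gradN/B0N.
have subB := rowspan_submodule B.
apply: submodule_mul => // a; rewrite DP big_seq.
apply: (big_ind (rowspan B)) => [|w x1 sw sx|d dD].
- exact: subB.1.
- by rewrite -[x1]scale1r; apply: subB.2.
have ds : (d, a) \in s.
  by apply/flatten_mapP; exists a; rewrite ?mem_enum // map_f.
have [c xc] : exists c, x c = (d, a).
  by have /tnthP[c ->] : (d, a) \in in_tuple s by []; exists c.
by have := rowspan_row B c; rewrite rowK xc.
Qed.

(** A homogeneous generating family with the least possible number of elements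
    has no relation with a unit coefficient: such a relation would express one
    generator through the others. *)
Lemma min_hom_generators q (dc : 'I_q -> int) (N : 'rV[R]_q -> Prop) :
  submodule N -> (forall d v, N v -> N (mxcomp (fun=> d) dc v)) ->
  exists r (dr : 'I_r -> int) (B : 'M_(r, q)), [/\ hom_mx dr dc B,
    forall v, N v <-> rowspan B v & forall u : 'rV_r, u *m B = 0 -> cst u = 0].
Proof.
move=> subN gradN.
pose gens r := exists (dr : 'I_r -> int) (B : 'M_(r, q)), [/\ hom_mx dr dc B,
    forall a, N (row a B) & forall v, N v -> rowspan B v].
have [r gensr minr] : exists2 r, gens r & forall r', (r' < r)%N -> ~ gens r'.
  have [r] := hom_generators subN gradN.
  elim/ltn_ind: r => r IH gr.
  have [[r' lt_r' gr']|nr] := classic (exists2 r', (r' < r)%N & gens r').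
    exact: IH gr'.
  by exists r => // r' lt_r' gr'; apply: nr; exists r'.
have [dr [B [homB BN NB]]] := gensr; exists r, dr, B; split=> // [v|u uB].
  by split=> [/NB //|[u ->]]; apply: submodule_mul.
apply/cst0P => z a; rewrite ord1 {z}; apply/eqP/negPn/negP => ua.
case: r => [|r] in dr B u a ua homB BN NB uB gensr minr *; first by case: a ua.
apply: (minr r) => //.
(* The component of u in the degree of the generator a is again a relation, and
   its coefficient at a is a nonzero constant. *)
pose u' := mxcomp (fun=> dr a) dr u.
have u'B : u' *m B = 0.
  rewrite /u' -(mxcompM _ _ homB) uB.
  by apply/matrixP => i j; rewrite !mxE linear0.
have u'a : u' 0 a = ((u 0 a)@_0%MM)%:MP by rewrite mxE subrr hcomp0E.
pose B' : 'M_(r, q) := \matrix_j row (lift a j) B.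
have subB' := rowspan_submodule B'.
have spB' b : rowspan B' (row b B).
  have [->|] := eqVneq b a; last first.
    rewrite eq_sym => /unlift_some[c -> _].
    by have := rowspan_row B' c; rewrite rowK.
  exists (- ((u 0 a)@_0%MM)^-1%:MP *: \row_j u' 0 (lift a j)).
  have : u' 0 a *: row a B + (\row_j u' 0 (lift a j)) *m B' = 0.
    rewrite -u'B [u' *m B]mulmx_sum_row (bigD1_ord a) //=; congr (_ + _).
    by rewrite mulmx_sum_row; apply: eq_bigr => j _; rewrite mxE rowK.
  move/eqP; rewrite addrC addr_eq0 => /eqP; rewrite -scalemxAl => ->.
  rewrite scalerN scaleNr opprK scalerA u'a -mpolyCM mulVf //.
  by rewrite mpolyC1 scale1r.
exists (fun j => dr (lift a j)), B'; split=> [i j|i|v /NB[w ->]].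
- by rewrite !mxE.
- by rewrite rowK.
- by apply: submodule_mul.
Qed.

End Grading.

(** * Minimal graded free resolutions *)

Section Resolutions.
Variables (n : nat) (k : fieldType).
Local Notation R := {mpoly k[n]}.

(** The differentials preserve degrees. *)
Definition graded_cplx (F : free_cplx n k) :=
  forall i, hom_mx (deg F i.+1) (deg F i) (dif F i).

(** Exactness in all positive degrees: the complex resolves the cokernel of
    [dif F 0]. *)
Definition exact_cplx (F : free_cplx n k) :=
  forall i v, v *m dif F i = 0 <-> rowspan (dif F i.+1) v.

(** The differentials vanish modulo the variables. *)
Definition minimal_cplx (F : free_cplx n k) := forall i, cst (dif F i) = 0.

(** Ideals that contain the homogeneous components of their elements. *)
Record graded_ideal (I : R -> Prop) : Prop := {
  gideal0 : I 0;
  gidealD : forall c p q, I p -> I q -> I (p + c * q);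
  gideal_hcomp : forall d p, I p -> I (hcomp d p)
}.

Lemma exact_difM F i : exact_cplx F -> dif F i.+1 *m dif F i = 0.
Proof.
move=> ex; apply/row_matrixP => a; rewrite row_mul row0.
by apply/ex; apply: rowspan_row.
Qed.

Lemma kermx_submodule p q (A : 'M[R]_(p, q)) : submodule (fun v => v *m A = 0).
Proof.
split=> [|c u v uA vA]; first by rewrite mul0mx.
by rewrite mulmxDl -scalemxAl uA vA scaler0 addr0.
Qed.

Lemma mxcomp0 p q (dr : 'I_p -> int) (dc : 'I_q -> int) :
  mxcomp dr dc (0 : 'M[R]_(p, q)) = 0.
Proof. by apply/matrixP => a b; rewrite !mxE linear0. Qed.

(** ** Existence *)

(** One map [smx : F_{i+1} -> F_i] of a resolution under construction, with the
    degrees of the basis vectors of its source and target. *)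
Record stage := Stage {
  srk : nat; trk : nat;
  sdeg : 'I_srk -> int; tdeg : 'I_trk -> int;
  smx : 'M[R]_(srk, trk)
}.

(** The rows of [smx s] are minimal homogeneous generators of their span, and
    they vanish modulo the variables. *)
Definition good_stage s :=
  [/\ hom_mx (@sdeg s) (@tdeg s) (smx s), cst (smx s) = 0
    & forall u : 'rV_(srk s), u *m smx s = 0 -> cst u = 0].

(** The data of a next map into the source of [s]. *)
Definition pre_stage s :=
  {r : nat & (('I_r -> int) * 'M[R]_(r, srk s))%type}.

Definition to_stage s (t : pre_stage s) : stage :=
  Stage (projT2 t).1 (@sdeg s) (projT2 t).2.

Lemma next_stage_ex s : good_stage s -> exists t : pre_stage s,
  good_stage (to_stage t) /\
  forall v, v *m smx s = 0 <-> rowspan (projT2 t).2 v.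
Proof.
case=> hom _ minA.
have [|r [dr [B [homB NB minB]]]] :=
    @min_hom_generators _ _ _ (@sdeg s) _ (kermx_submodule (smx s)).
  by move=> d v vA; rewrite -(mxcompM _ _ hom) vA mxcomp0.
exists (existT _ r (dr, B)); split=> //; split=> //=.
apply/row_matrixP => a; rewrite -cst_row minA ?row0 //.
by apply/NB; apply: rowspan_row.
Qed.

(** A next map whose rows are minimal homogeneous generators of the kernel of
    the map of [s]. *)
Definition next_stage s : stage :=
  to_stage (epsilon (inhabits (existT _ 0%N (fun=> 0, 0) : pre_stage s))
    (fun t => good_stage (to_stage t) /\
              forall v, v *m smx s = 0 <-> rowspan (projT2 t).2 v)).

Lemma next_stageP s : good_stage s -> good_stage (next_stage s) /\
  forall v, v *m smx s = 0 <-> rowspan (smx (next_stage s)) v.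
Proof.
by move/next_stage_ex => ex; apply: (epsilon_spec (inhabits _) _ ex).
Qed.

Fixpoint stages s i : stage :=
  if i is i'.+1 then next_stage (stages s i') else s.

(** The source of each stage is the target of the next one by computation, so
    that the maps are composable without casts. *)
Definition stage_cplx s (aug : 'cV[R]_(trk s)) : free_cplx n k :=
  @FreeCplx n k (fun i => trk (stages s i)) (fun i => @tdeg (stages s i)) aug
    (fun i => smx (stages s i)).

(** The resolution provided has the ring itself in degree 0, up to an
    isomorphism of degree 0. *)
Lemma min_res_exists (I : R -> Prop) :
  graded_ideal I -> (forall p, I p -> p@_0%MM = 0) ->
  exists F : free_cplx n k, [/\ min_graded_free_res I F,
    forall a, deg F 0 a = 0
    & exists2 e : 'rV_(rk F 0), aug F *m e = 1%:M & e *m aug F = 1%:M].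
Proof.
move=> gI I0.
pose N (v : 'rV[R]_1) := I (v 0 0).
have subN : submodule N.
  split=> [|c u v]; rewrite /N !mxE; first exact: gideal0 gI.
  exact: gidealD gI c _ _.
have [|r [dr [B [homB NB minB]]]] :=
    @min_hom_generators _ _ _ (fun=> 0) _ subN.
  by move=> d v Nv; rewrite /N mxE; apply: gideal_hcomp gI _ _ Nv.
pose s := Stage dr (fun=> 0) B.
have goodS : good_stage s.
  split=> //; apply/cst0P => a b; rewrite ord1.
  have : N (row a B) by apply/NB; apply: rowspan_row.
  by rewrite /N mxE; apply: I0.
have good i : good_stage (stages s i).
  by elim: i => [|i /next_stageP[]].
exists (@stage_cplx s 1%:M); split=> //; last by exists 1%:M; rewrite mulmx1.
split=> /=.
- by move=> a; rewrite (ord1 a) mxE; apply: homogz1.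
- by move=> i a b; have [h _ _] := good i; apply: h.
- move=> p; exists p%:M; rewrite mulmx1 mxE eqxx mulr1n subrr.
  exact: gideal0.
- by move=> v; rewrite mulmx1; apply: NB.
- by move=> i v; have [_] := next_stageP (good i); apply.
- by move=> i a b; have [_ /cst0P h _] := good i; apply: h.
Qed.

(** ** Uniqueness of the numbers of generators *)

Lemma res_graded I F : min_graded_free_res I F -> graded_cplx F.
Proof. by move=> resF i a b; apply: res_dif_homog resF _ _ _. Qed.

Lemma res_exact I F : min_graded_free_res I F -> exact_cplx F.
Proof. by move=> resF i v; apply: res_exactS resF _ _. Qed.

Lemma res_min I F : min_graded_free_res I F -> minimal_cplx F.
Proof. by move=> resF i; apply/cst0P; apply: res_minimal resF _. Qed.

(** A map in degree 0 that respects the images of the first differentials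
    extends to a degree-preserving map of complexes. *)
Lemma comparison F G (f0 : 'M[R]_(rk F 0, rk G 0)) :
  graded_cplx F -> graded_cplx G -> exact_cplx G ->
  (forall i, dif F i.+1 *m dif F i = 0) ->
  hom_mx (deg F 0) (deg G 0) f0 ->
  (forall a, rowspan (dif G 0) (row a (dif F 0 *m f0))) ->
  exists f : forall i, 'M[R]_(rk F i, rk G i), [/\ f 0%N = f0,
    forall i, hom_mx (deg F i) (deg G i) (f i)
    & forall i, f i.+1 *m dif G i = dif F i *m f i].
Proof.
move=> gF gG exG ddF hom0 span0.
pose Q i (f : 'M[R]_(rk F i, rk G i)) := hom_mx (deg F i) (deg G i) f /\
  forall a, rowspan (dif G i) (row a (dif F i *m f)).
have step i f : Q i f -> exists f', Q i.+1 f' /\ f' *m dif G i = dif F i *m f.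
  case=> homf /(hom_mx_lift (hom_mx_mul (gF i) homf) (gG i))[U homU eU].
  exists U; split=> //; split=> // a; apply/exG.
  by rewrite -row_mul -mulmxA -eU mulmxA ddF mul0mx row0.
pose next i f := epsilon (inhabits (0 : 'M[R]_(rk F i.+1, rk G i.+1)))
  (fun f' => Q i.+1 f' /\ f' *m dif G i = dif F i *m f).
pose fix f i : 'M[R]_(rk F i, rk G i) :=
  if i is i'.+1 then next i' (f i') else f0.
have nextP i g : Q i g ->
    Q i.+1 (next i g) /\ next i g *m dif G i = dif F i *m g.
  by move/step => ex; apply: (epsilon_spec (inhabits _) _ ex).
have Qf i : Q i (f i) by elim: i => [|i /nextP[]].
by exists f; split=> // i; [case: (Qf i) | have [] := nextP _ _ (Qf i)].
Qed.

(** An endomorphism of a minimal resolution over the identity of [R/I] is the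
    identity modulo the variables: it is homotopic to the identity, and the
    homotopy terms contain a differential as a factor. *)
Lemma homotopic_id I F (h : forall i, 'M[R]_(rk F i)) :
  min_graded_free_res I F ->
  (forall v : 'rV_(rk F 0), I ((v *m (1%:M - h 0%N) *m aug F) 0 0)) ->
  (forall i, h i.+1 *m dif F i = dif F i *m h i) ->
  forall i, cst (1%:M - h i) = 0.
Proof.
move=> resF h0 hS.
have minF := res_min resF; have exF := res_exact resF.
have lift i (A : 'M_(rk F i)) : (forall a, rowspan (dif F i) (row a A)) ->
    exists U, A = U *m dif F i.
  move=> sp; have [f fP] := fin_all_exists sp; exists (\matrix_a f a).
  by apply/row_matrixP => a; rewrite row_mul rowK.
suff main i : exists2 s : 'M_(rk F i, rk F i.+1), cst (1%:M - h i) = 0 &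
    dif F i *m s *m dif F i = dif F i *m (1%:M - h i).
  by move=> i; have [] := main i.
elim: i => [|i [s _ sP]].
  have [a|s sP] := @lift 0%N (1%:M - h 0%N).
    by apply/(res_exact0 resF); rewrite rowE.
  by exists s; rewrite sP ?cstM ?minF ?mulmx0 ?mulmxA.
have [a|t tP] := @lift i.+1 (1%:M - h i.+1 - dif F i *m s).
  apply/exF; rewrite -row_mul !mulmxBl mul1mx hS sP mulmxBr mulmx1.
  by rewrite subrr row0.
have eh : 1%:M - h i.+1 = t *m dif F i.+1 + dif F i *m s by rewrite -tP subrK.
exists t; rewrite eh.
  by apply/eqP; rewrite /cst map_mxD -!/(cst _) !cstM !minF mulmx0 mul0mx addr0.
by rewrite mulmxDr !mulmxA exact_difM // mul0mx addr0.
Qed.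

(** Modulo the variables, a homogeneous map relates only basis vectors of equal
    degrees, so a map with a right inverse is injective degree by degree. *)
Lemma count_le p q (dr : 'I_p -> int) (dc : 'I_q -> int)
    (A : 'M[R]_(p, q)) (B : 'M[R]_(q, p)) j :
  hom_mx dr dc A -> hom_mx dc dr B -> cst (1%:M - A *m B) = 0 ->
  (#|[set a | dr a == j]| <= #|[set b | dc b == j]|)%N.
Proof.
move=> homA homB AB1.
have {}AB1 : cst A *m cst B = 1%:M.
  move: AB1; rewrite -cstM /cst map_mxB map_mx1 => /eqP.
  by rewrite subr_eq0 => /eqP.
set X := [set a | _]; set Y := [set b | _].
pose f (a : 'I_#|X|) := enum_val a; pose g (b : 'I_#|Y|) := enum_val b.
pose A' := mxsub f g (cst A); pose B' := mxsub g f (cst B).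
suff e : A' *m B' = 1%:M.
  apply: leq_trans (rank_leq_col A'); rewrite -[X in (X <= _)%N](mxrank1 k) -e.
  exact: mxrankM_maxl.
apply/matrixP => a a'; rewrite !mxE.
have := congr1 (fun M : 'M_p => M (f a) (f a')) AB1; rewrite !mxE.
rewrite (inj_eq (@enum_val_inj _ _)) => <-.
rewrite (bigID (mem Y)) /= [X in _ = _ + X]big1 ?addr0 => [|b bY]; last first.
  rewrite !mxE (homogz_cst0 (homA _ _)) ?mul0r //.
  have := enum_valP a; rewrite !inE in bY *; rewrite -/(f a) => /eqP ->.
  by rewrite subr_eq0 eq_sym.
rewrite (big_enum_val (A := mem Y)) /=.
by apply: eq_bigr => b _; rewrite !mxE.
Qed.

Lemma res_count_le I F G i j : graded_ideal I ->
  min_graded_free_res I F -> min_graded_free_res I G ->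
  (#|[set a | deg F i a == j]| <= #|[set a | deg G i a == j]|)%N.
Proof.
move=> gI resF resG.
have lift0 F' G' : min_graded_free_res I F' -> min_graded_free_res I G' ->
    exists2 f0 : 'M[R]_(rk F' 0, rk G' 0), hom_mx (deg F' 0%N) (deg G' 0%N) f0 &
      forall v : 'rV_(rk F' 0), I ((v *m (aug F' - f0 *m aug G')) 0 0).
  move=> resF' resG'.
  have [f fP] := fin_all_exists (fun a => res_aug_surj resG' (aug F' a 0)).
  pose f0 := mxcomp (deg F' 0%N) (deg G' 0%N) (\matrix_a f a).
  exists f0; first exact: mxcomp_hom.
  have homF : hom_mx (deg F' 0%N) (fun _ : 'I_1 => 0) (aug F').
    by move=> a b; rewrite ord1 subr0; apply: res_aug_homog resF' _.
  have homG : hom_mx (deg G' 0%N) (fun _ : 'I_1 => 0) (aug G').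
    by move=> a b; rewrite ord1 subr0; apply: res_aug_homog resG' _.
  have Irow a : I ((aug F' - f0 *m aug G') a 0).
    have := gideal_hcomp gI (deg F' 0%N a) (fP a).
    congr I; rewrite linearB /= hcomp_id; last first.
      by apply: res_aug_homog resF' _.
    rewrite /f0 -(mxcompM _ _ homG) !mxE subr0.
    by congr (_ - hcomp _ _); apply: eq_bigr => b _; rewrite !mxE.
  move=> v; rewrite mxE; apply: (big_ind I); first exact: gideal0 gI.
    by move=> x y Ix Iy; rewrite -[y]mul1r; apply: gidealD gI _ _ _ Ix Iy.
  by move=> a _; rewrite -[_ * _]add0r; apply: gidealD gI _ _ _ (gideal0 gI) _.
have extend F' G' : min_graded_free_res I F' -> min_graded_free_res I G' ->
    exists f : forall i, 'M[R]_(rk F' i, rk G' i), [/\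
      forall v : 'rV_(rk F' 0), I ((v *m (aug F' - f 0%N *m aug G')) 0 0),
      forall i, hom_mx (deg F' i) (deg G' i) (f i)
      & forall i, f i.+1 *m dif G' i = dif F' i *m f i].
  move=> resF' resG'; have [f0 homf0 f0P] := lift0 _ _ resF' resG'.
  have [|||||a|f [ef homf fS]] := @comparison F' G' f0.
  - exact: res_graded resF'.
  - exact: res_graded resG'.
  - exact: res_exact resG'.
  - by move=> i'; apply: exact_difM (res_exact resF').
  - exact: homf0.
  - apply/(res_exact0 resG').
    have IF : I ((row a (dif F' 0) *m aug F') 0 0).
      by apply/(res_exact0 resF'); apply: rowspan_row.
    have := gidealD gI (-1) IF (f0P (row a (dif F' 0))).
    congr I; rewrite mulN1r row_mul -mulmxA.
    set w := row a _; rewrite mulmxBr; move: (w *m _) (w *m _) => x y.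
    by rewrite !mxE opprB addrC subrK.
  by exists f; split; [rewrite ef | exact: homf | exact: fS].
have [f [f0 homf fS]] := extend _ _ resF resG.
have [g [g0 homg gS]] := extend _ _ resG resF.
apply: (count_le _ (homf i) (homg i)).
apply: (homotopic_id (h := fun i => f i *m g i) resF) => [v|i'].
  have -> : v *m (1%:M - f 0%N *m g 0%N) *m aug F
    = v *m (aug F - f 0%N *m aug G) + v *m f 0%N *m (aug G - g 0%N *m aug F).
    by rewrite -mulmxA mulmxBl mul1mx !mulmxBr !mulmxA subrKA.
  by rewrite mxE -[X in _ + X]mul1r; apply: gidealD gI _ _ _ (f0 v) (g0 _).
by rewrite -mulmxA gS mulmxA fS mulmxA.
Qed.

(** The choice of a resolution in the definition of [betti] is immaterial. *)
Lemma bettiE I F i j : graded_ideal I -> min_graded_free_res I F ->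
  betti I i j = #|[set a | deg F i a == j]|.
Proof.
move=> gI resF.
have /(epsilon_spec (inhabits 0%N)) : exists b, exists F' : free_cplx n k,
    min_graded_free_res I F' /\ b = #|[set a | deg F' i a == j]|.
  by exists #|[set a | deg F i a == j]|, F.
case=> F' [resF' eb]; rewrite /betti eb.
by apply/eqP; rewrite eqn_leq !(@res_count_le I).
Qed.

End Resolutions.

(** * Monomial ideals *)

Section MonomialIdeals.
Variables (n : nat) (k : fieldType).
Local Notation R := {mpoly k[n]}.
Implicit Types (D : pred 'X_{1..n}) (p q r : R) (u : 'X_{1..n}).

(** The polynomials all of whose monomials lie in [D]: an ideal when [D] is
    closed under multiples. *)
Definition mon_ideal D p := forall m, p@_m != 0 -> D m.

(** Closure under multiples. *)
Definition up_closed D := forall u m, D m -> D (m + u)%MM.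

Lemma mon_ideal0 D : mon_ideal D 0.
Proof. by move=> m; rewrite mcoeff0 eqxx. Qed.

Lemma mon_idealD D p q : mon_ideal D p -> mon_ideal D q -> mon_ideal D (p + q).
Proof.
move=> Dp Dq m; rewrite mcoeffD; have [p0|/Dp //] := eqVneq p@_m 0.
by rewrite p0 add0r => /Dq.
Qed.

Lemma mon_idealM D c p : up_closed D -> mon_ideal D p -> mon_ideal D (c * p).
Proof.
move=> upD Dp m; rewrite -mcoeff_msupp => /msuppM_le /allpairsP[[m1 m2] /=].
by case=> _; rewrite mcoeff_msupp => /Dp Dm2 ->; rewrite addmC; apply: upD.
Qed.

Lemma mon_idealX D c m : D m -> mon_ideal D (c *: 'X_[m]).
Proof.
move=> Dm m'; rewrite mcoeffZ mcoeffX.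
by have [<- //|_] := eqVneq m m'; rewrite mulr0 eqxx.
Qed.

Lemma mon_ideal_sub D D' p :
  {subset D <= D'} -> mon_ideal D p -> mon_ideal D' p.
Proof. by move=> sub Dp m /Dp; apply: sub. Qed.

Lemma mon_ideal_graded D : up_closed D -> graded_ideal (mon_ideal D).
Proof.
move=> upD; split=> [|c p q Dp Dq|d p Dp m]; first exact: mon_ideal0.
  by apply: mon_idealD => //; apply: mon_idealM.
by rewrite mcoeff_hcomp; case: ifP => [_ /Dp|]; rewrite ?eqxx.
Qed.

Lemma mon_ideal_sum D (s : seq 'X_{1..n}) (P : pred 'X_{1..n})
    (F : 'X_{1..n} -> R) :
  (forall m, m \in s -> P m -> mon_ideal D (F m)) ->
  mon_ideal D (\sum_(m <- s | P m) F m).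
Proof.
move=> DF; rewrite big_seq_cond; apply: big_ind => [|p q|m /andP[ms Pm]].
- exact: mon_ideal0.
- exact: mon_idealD.
- exact: DF.
Qed.

(** A polynomial whose monomials lie in [D1] or in the multiples by [u] of [D2]
    splits accordingly. *)
Lemma mon_ideal_split D D1 D2 u p :
  (forall m, D m -> D1 m || (u <= m)%MM && D2 (m - u)%MM) -> mon_ideal D p ->
  exists q r, [/\ mon_ideal D1 q, mon_ideal D2 r & p = q + r * 'X_[u]].
Proof.
move=> cover Dp; exists (\sum_(m <- msupp p | D1 m) p@_m *: 'X_[m]).
exists (\sum_(m <- msupp p | ~~ D1 m) p@_m *: 'X_[(m - u)%MM]).
have cov m : m \in msupp p -> ~~ D1 m -> (u <= m)%MM && D2 (m - u)%MM.
  by rewrite mcoeff_msupp => /Dp /cover /orP[->|].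
split.
- by apply: mon_ideal_sum => m _; apply: mon_idealX.
- by apply: mon_ideal_sum => m mp /(cov _ mp)/andP[_]; apply: mon_idealX.
rewrite {1}[p]mpolyE (bigID D1) /=; congr (_ + _).
rewrite mulr_suml big_seq_cond [RHS]big_seq_cond.
apply: eq_bigr => m /andP[mp /(cov _ mp)/andP[le_um _]].
by rewrite -scalerAl -mpolyXD submK.
Qed.

(** A criterion for the monomial [u] to be regular modulo a monomial ideal. *)
Lemma mon_ideal_nzd D u p :
  (forall m, D (m + u)%MM -> D m) -> mon_ideal D (p * 'X_[u]) -> mon_ideal D p.
Proof. by move=> Du Dp m pm; apply/Du/Dp; rewrite addmC mcoeffMX. Qed.

(** Divisibility by some variable in [s]: the monomials of the ideal generated
    by these variables. *)
Definition var_dvd (s : seq 'I_n) : pred 'X_{1..n} :=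
  fun m => has (fun x => 0 < m x)%N s.

Lemma var_dvd_up s : up_closed (var_dvd s).
Proof.
move=> u m /hasP[x xs mx]; apply/hasP; exists x => //.
by rewrite mnmDE ltn_addr.
Qed.

Lemma var_ideal_cons x s p : mon_ideal (var_dvd (x :: s)) p <->
  exists q r, mon_ideal (var_dvd s) q /\ p = q + r * 'X_x.
Proof.
split=> [|[q [r [Dq ->]]]].
  case/(@mon_ideal_split _ (var_dvd s) predT U_(x)%MM)
    => [m /=|q [r [Dq _ ->]]].
    by rewrite andbT /var_dvd /= lep1mP -lt0n orbC.
  by exists q, r.
have upD := @var_dvd_up (x :: s).
apply: mon_idealD; last apply: mon_idealM => //.
  by apply: mon_ideal_sub Dq => m; rewrite /in_mem /= /var_dvd /= orbC => ->.
rewrite -['X_x]scale1r; apply: mon_idealX.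
by rewrite /var_dvd /= mnm1E eqxx.
Qed.

Lemma var_ideal_nzd x s p : x \notin s ->
  mon_ideal (var_dvd s) (p * 'X_x) -> mon_ideal (var_dvd s) p.
Proof.
move=> xs; apply: mon_ideal_nzd => m /hasP[y ys]; rewrite mnmDE mnm1E.
have [xy|_] := eqVneq x y; first by rewrite xy ys in xs.
by rewrite addn0 => my; apply/hasP; exists y.
Qed.

End MonomialIdeals.

(** * Mapping cones *)

Section Cones.
Variables (n : nat) (k : fieldType).
Local Notation R := {mpoly k[n]}.
Implicit Types F C : free_cplx n k.

(** Twist by [-w]: all degrees of basis vectors are increased by [w]. *)
Definition shift_cplx (w : int) F : free_cplx n k :=
  @FreeCplx n k (rk F) (fun i a => deg F i a + w) (aug F) (dif F).

(** The complex with the term in degree 0 removed; its augmentation is the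
    composite of the removed map with the former augmentation. *)
Definition trunc_cplx F : free_cplx n k :=
  @FreeCplx n k (fun i => rk F i.+1) (fun i => deg F i.+1)
    (dif F 0 *m aug F) (fun i => dif F i.+1).

(** The degrees of the basis of a direct sum. *)
Definition sum_deg p q (d1 : 'I_p -> int) (d2 : 'I_q -> int) (a : 'I_(p + q)) :=
  match split a with inl b => d1 b | inr c => d2 c end.

Definition cone_rk C F i := if i is i'.+1 then (rk F i + rk C i')%N else rk F 0.

Definition cone_deg C F i : 'I_(cone_rk C F i) -> int :=
  if i is i'.+1 then sum_deg (deg F i'.+1) (deg C i') else deg F 0.

(** The differential [(u, v) |-> (u d + v f, - v d)] on row vectors. *)
Definition cone_dif C F (f : forall i, 'M[R]_(rk C i, rk F i)) i :
    'M[R]_(cone_rk C F i.+1, cone_rk C F i) :=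
  if i is i'.+1 then block_mx (dif F i'.+1) 0 (f i'.+1) (- dif C i')
  else col_mx (dif F 0) (f 0%N).

(** The mapping cone of [f : C -> F], with [F] as subcomplex. *)
Definition cone C F (f : forall i, 'M[R]_(rk C i, rk F i)) : free_cplx n k :=
  @FreeCplx n k (cone_rk C F) (@cone_deg C F) (aug F) (cone_dif f).

Lemma hom_col_mx p1 p2 q (d1 : 'I_p1 -> int) (d2 : 'I_p2 -> int)
    (dc : 'I_q -> int) (A : 'M[R]_(p1, q)) (B : 'M[R]_(p2, q)) :
  hom_mx d1 dc A -> hom_mx d2 dc B -> hom_mx (sum_deg d1 d2) dc (col_mx A B).
Proof. by move=> hA hB a b; rewrite /sum_deg mxE; case: split. Qed.

Lemma hom_row_mx p q1 q2 (dr : 'I_p -> int) (d1 : 'I_q1 -> int)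
    (d2 : 'I_q2 -> int) (A : 'M[R]_(p, q1)) (B : 'M[R]_(p, q2)) :
  hom_mx dr d1 A -> hom_mx dr d2 B -> hom_mx dr (sum_deg d1 d2) (row_mx A B).
Proof. by move=> hA hB a b; rewrite /sum_deg mxE; case: split. Qed.

Lemma hom_mx0 p q (dr : 'I_p -> int) (dc : 'I_q -> int) :
  hom_mx dr dc (0 : 'M[R]_(p, q)).
Proof. by move=> a b; rewrite mxE; apply: homogz0. Qed.

Lemma shift_graded w C : graded_cplx C -> graded_cplx (shift_cplx w C).
Proof.
move=> gC i a b /=; have := gC i a b.
by congr homogz; rewrite opprD addrACA subrr addr0.
Qed.

Lemma cone_graded C F (f : forall i, 'M[R]_(rk C i, rk F i)) :
  graded_cplx C -> graded_cplx F ->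
  (forall i, hom_mx (deg C i) (deg F i) (f i)) ->
  graded_cplx (cone f).
Proof.
move=> gC gF homf [|i]; apply: hom_col_mx => //; apply: hom_row_mx => //.
  exact: hom_mx0.
by move=> a b; rewrite mxE; apply/homogzN/gC.
Qed.

Lemma cst0 p q : cst (0 : 'M[R]_(p, q)) = 0.
Proof. exact: map_mx0. Qed.

Lemma cone_minimal C F (f : forall i, 'M[R]_(rk C i, rk F i)) :
  minimal_cplx C -> minimal_cplx F -> (forall i, cst (f i) = 0) ->
  minimal_cplx (cone f).
Proof.
move=> mC mF f0 [|i] /=; rewrite /cone_dif /cst ?map_block_mx ?map_col_mx.
  by rewrite -!/(cst _) mF f0 col_mx0.
by rewrite map_mxN -!/(cst _) mF f0 mC cst0 oppr0 block_mx0.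
Qed.

(** The long exact sequence of the cone: it resolves the cokernel of the map of
    cokernels induced by [f], provided that this map is injective. *)
Lemma cone_exact C F (f : forall i, 'M[R]_(rk C i, rk F i)) :
  exact_cplx C -> exact_cplx F ->
  (forall i, f i.+1 *m dif F i = dif C i *m f i) ->
  (forall v, rowspan (dif F 0) (v *m f 0%N) -> rowspan (dif C 0) v) ->
  exact_cplx (cone f).
Proof.
move=> exC exF fS inj.
have lift i (u : 'rV_(rk F i.+1)) (v : 'rV_(rk C i)) : rowspan (dif C i) v ->
    u *m dif F i + v *m f i = 0 ->
    exists t, row_mx u v = t *m cone_dif f i.+1.
  case=> v' ->; rewrite -mulmxA -fS mulmxA -mulmxDl => /exF[u' eu].
  exists (row_mx u' (- v')); rewrite mul_row_block mulmx0 add0r mulNmx mulmxN.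
  by rewrite mulNmx opprK -eu addrK.
have dd i t : t *m cone_dif f i.+1 *m cone_dif f i = 0.
  rewrite -mulmxA [_ *m cone_dif f i](_ : _ = 0) ?mulmx0 //.
  case: i {t} => [|i] /=.
    by rewrite mul_block_col exact_difM // mul0mx addr0 mulNmx fS subrr col_mx0.
  rewrite mulmx_block !exact_difM // !(mul0mx, mulmx0, mulNmx, mulmxN) !addr0.
  by rewrite fS subrr opprK exact_difM // addr0 block_mx0.
move=> i v; split=> [|[t ->]]; last exact: dd.
rewrite -[v]hsubmxK; case: i v => [|i] v /=.
  rewrite mul_row_col => e; apply: lift => //; apply: inj.
  by exists (- lsubmx v); rewrite mulNmx -[RHS]addr0 -e addKr.
rewrite mul_row_block mulmx0 add0r mulmxN => e.
have := congr1 lsubmx e; have := congr1 rsubmx e.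
rewrite !row_mxKl !row_mxKr !linear0 => /eqP; rewrite oppr_eq0 => /eqP /exC sv.
exact: lift.
Qed.

(** The number of basis vectors of degree [j]. *)
Definition count_deg F i (j : int) := #|[set a | deg F i a == j]|.

Lemma count_shift w F i j :
  count_deg (shift_cplx w F) i j = count_deg F i (j - w).
Proof.
by apply: eq_card => a; rewrite !inE /= -[in RHS](can_eq (addrK w)) subrK.
Qed.

Lemma count_cone C F (f : forall i, 'M[R]_(rk C i, rk F i)) i j :
  count_deg (cone f) i.+1 j = (count_deg F i.+1 j + count_deg C i j)%N.
Proof.
rewrite /count_deg -!sum1_card big_mkcond big_split_ord /=; congr (_ + _)%N;
  rewrite [RHS]big_mkcond; apply: eq_bigr => a _; rewrite !inE /sum_deg.
  by rewrite (unsplitK (inl a)).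
by rewrite (unsplitK (inr a)).
Qed.

(** Complexes resolving a cyclic module: the augmentation is an isomorphism
    onto the ring, so that the image of [dif F 0] is identified with an
    ideal. *)
Definition unit_aug F (e : 'rV[R]_(rk F 0)) :=
  aug F *m e = 1%:M /\ e *m aug F = 1%:M.

Arguments unit_aug : clear implicits.

Lemma unit_aug_span F e v : unit_aug F e ->
  rowspan (dif F 0) v <-> rowspan (dif F 0 *m aug F) (v *m aug F).
Proof.
case=> ae ea; split=> [[u ->]|[u eu]]; first by exists u; rewrite mulmxA.
by exists u; rewrite -[v]mulmx1 -ae mulmxA eu !mulmxA -mulmxA ae mulmx1.
Qed.

(** ** The Koszul complex of a list of variables *)

(** The ring, placed in degree 0. *)
Definition ring_cplx : free_cplx n k :=
  @FreeCplx n k (fun i => (i == 0%N)%N : nat) (fun i _ => i%:Z) 1%:M (fun=> 0).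

(** The cone of multiplication by [x] on the Koszul complex of the other
    variables. *)
Fixpoint koszul (s : seq 'I_n) : free_cplx n k :=
  if s is x :: s' then
    @cone (shift_cplx 1 (koszul s')) (koszul s') (fun i => ('X_x)%:M)
  else ring_cplx.

Lemma koszul_rk s i : rk (koszul s) i = 'C(size s, i).
Proof.
elim: s i => [|x s IH] [|i] /=; rewrite ?bin0 ?bin0n //.
  by rewrite IH bin0.
by rewrite binS !IH.
Qed.

Lemma koszul_deg s i a : deg (koszul s) i a = i%:Z.
Proof.
elim: s i a => [|x s IH] [|i] a //=; rewrite /sum_deg.
by case: split => b /=; rewrite IH //; lia.
Qed.

Lemma koszul_unit_aug s : exists e, unit_aug (koszul s) e.
Proof. by elim: s => [|x s //]; exists 1%:M; split; rewrite mulmx1. Qed.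

Lemma koszul_aug_hom s :
  hom_mx (deg (koszul s) 0) (fun _ : 'I_1 => 0) (aug (koszul s)).
Proof.
elim: s => [|x s //] a b; rewrite /= mxE.
by rewrite !ord1; apply: homogz1.
Qed.

Lemma homogzX x : homogz 1 ('X_x : R).
Proof. by rewrite /= dhomogX; apply/eqP/mdeg1. Qed.

Lemma koszul_graded s : graded_cplx (koszul s).
Proof.
elim: s => [|x s IH]; first by move=> i; apply: hom_mx0.
apply: cone_graded => //; first exact: shift_graded.
move=> i a b; rewrite /= !koszul_deg addrAC subrr add0r mxE.
by case: eqP => _; rewrite ?mulr0n ?mulr1n; [apply: homogzX | apply: homogz0].
Qed.

Lemma koszul_minimal s : minimal_cplx (koszul s).
Proof.
elim: s => [|x s IH]; first by move=> i; apply: cst0.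
apply: cone_minimal => // i; apply/cst0P => a b; rewrite mxE.
case: eqP => _; rewrite ?mulr0n ?mulr1n ?mcoeff0 //.
exact: homogz_cst0 (homogzX x) _.
Qed.

Lemma koszul_ideal s p :
  rowspan (dif (koszul s) 0 *m aug (koszul s)) p%:M <-> mon_ideal (var_dvd s) p.
Proof.
elim: s p => [|x s IH] p /=.
  split=> [[u]|h].
    rewrite mul0mx mulmx0 => /matrixP/(_ 0 0); rewrite !mxE eqxx mulr1n => ->.
    exact: mon_ideal0.
  exists 0; rewrite mul0mx (_ : p = 0) ?raddf0 //.
  by apply/mpolyP => m; rewrite mcoeff0; apply/eqP/negPn/negP => /h.
rewrite var_ideal_cons; have [e [ae ea]] := koszul_unit_aug s.
rewrite mul_col_mx mul_scalar_mx; split=> [[u]|[q [r [/IH[u eu] ->]]]].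
  rewrite -[u]hsubmxK mul_row_col -scalemxAr.
  set u1 := lsubmx u; set u2 := rsubmx u.
  move=> /matrixP/(_ 0 0); rewrite !mxE eqxx mulr1n => ->.
  set q := \sum_j _; exists q, ((u2 *m aug (koszul s)) 0 0); split.
    apply/IH; exists u1; apply/matrixP => i j; rewrite !ord1 [RHS]mxE.
    by rewrite mxE eqxx mulr1n.
  by rewrite mulrC !mxE.
exists (row_mx u (r *: e)); rewrite mul_row_col -eu -scalemxAl.
rewrite -scalemxAr ea; apply/matrixP => i j; rewrite !ord1 !mxE eqxx.
by rewrite !mulr1n mulr1.
Qed.

Lemma koszul_exact s : uniq s -> exact_cplx (koszul s).
Proof.
elim: s => [|x s IH] /= => [_ i v|/andP[xs us]].
  split=> [_|_]; last by rewrite mulmx0.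
  by exists 0; rewrite mul0mx; apply: thinmx0.
apply: cone_exact; [exact: IH | exact: IH | |].
  by move=> i; rewrite mul_scalar_mx mul_mx_scalar.
move=> v; have [e ue] := koszul_unit_aug s.
rewrite /= !(unit_aug_span _ ue) mul_mx_scalar -scalemxAl.
rewrite [v *m _]mx11_scalar scale_scalar_mx !koszul_ideal mulrC.
exact: var_ideal_nzd.
Qed.

End Cones.

Arguments unit_aug {n k} F e.

(** * Adding a power of a variable times an ideal of variables *)

Section Splitting.
Variables (n : nat) (k : fieldType).
Local Notation R := {mpoly k[n]}.
Implicit Types F : free_cplx n k.

(** Past the term in degree 0, a minimal resolution of [R/J] lives in degrees
    that exceed the homological degree, when [J] starts in degree 2. *)
Lemma res_deg_gt (J : R -> Prop) F e :
  min_graded_free_res J F -> unit_aug F e -> (forall a, deg F 0 a = 0) ->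
  (forall p, J p -> forall m, p@_m != 0 -> (1 < mdeg m)%N) ->
  forall i a, i%:Z + 2 <= deg F i.+1 a.
Proof.
move=> resF [ae ea] deg0 J2.
have exF := res_exact resF; have gF := res_graded resF.
have minF := res_min resF.
have nz i a : exists b, dif F i a b != 0.
  have [/existsP//|none] := boolP [exists b, dif F i a b != 0].
  (* Otherwise the basis vector a is a cycle, hence a boundary. *)
  have /exF[u eu] : delta_mx 0 a *m dif F i = 0 :> 'rV[R]_(rk F i).
    rewrite -rowE; apply/rowP => b; rewrite !mxE.
    by apply/eqP/negPn; move/existsPn: none; apply.
  have := congr1 (@cst _ _ _ _) eu; rewrite cstM minF mulmx0.
  move/cst0P/(_ 0 a); rewrite mxE !eqxx mcoeff1 eqxx => /eqP.
  by rewrite oner_eq0.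
have supp (p : R) : p != 0 -> exists m, p@_m != 0.
  by exists (mlead p); rewrite mleadc_eq0.
elim=> [|i IH] a.
  have Ja : J ((row a (dif F 0) *m aug F) 0 0).
    by apply/(res_exact0 resF); apply: rowspan_row.
  have /supp[m pm] : (row a (dif F 0) *m aug F) 0 0 != 0.
    have [b] := nz 0%N a; apply: contra_neq => p0.
    have : row a (dif F 0) *m aug F = 0 by rewrite [LHS]mx11_scalar p0 raddf0.
    move/(congr1 (mulmx^~ e)); rewrite -mulmxA ae mulmx1 mul0mx.
    by move/rowP/(_ b); rewrite !mxE.
  have homF : hom_mx (deg F 0) (fun _ : 'I_1 => 0) (aug F).
    by move=> c b; rewrite ord1 subr0; apply: res_aug_homog resF _.
  have := hom_mx_mul (gF 0%N) homF a 0; rewrite subr0 => /homogzP/(_ m).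
  rewrite -row_mul mxE in pm; move=> /(_ pm) <-.
  by rewrite add0r lez_nat; apply: J2 Ja _ _; rewrite -row_mul mxE.
have [b /supp[m pm]] := nz i.+1 a.
have em := (homogzP _ _).1 (gF i.+1 a b) m pm.
have m0 : mdeg m != 0%N.
  rewrite mdeg_eq0; apply: contra_neq pm => ->.
  by have /cst0P := minF i.+1; apply.
have := IH b; lia.
Qed.

(** The inverse of a homogeneous isomorphism is homogeneous. *)
Lemma unit_aug_hom F e : hom_mx (deg F 0) (fun _ : 'I_1 => 0) (aug F) ->
  unit_aug F e -> hom_mx (fun _ : 'I_1 => 0) (deg F 0%N) e.
Proof.
move=> homF [ae ea].
have hom1 : hom_mx (fun _ : 'I_1 => 0) (fun _ : 'I_1 => 0) (1%:M : 'M[R]_1).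
  by move=> a b; rewrite mxE !ord1 eqxx; apply: homogz1.
have e'a : mxcomp (fun=> 0) (deg F 0) e *m aug F = 1%:M.
  by rewrite -(mxcompM _ _ homF) ea mxcomp_id.
have -> : e = mxcomp (fun=> 0) (deg F 0) e.
  by rewrite -[RHS]mulmx1 -ae mulmxA e'a mul1mx.
exact: mxcomp_hom.
Qed.

Lemma homogzXn x w : homogz w%:Z ('X_x ^+ w : R).
Proof.
rewrite /= mpolyXn dhomogX; apply/eqP.
by rewrite [LHS]mdegMn mdeg1 mul1n.
Qed.

Lemma homogz_scalar d p (dr dc : 'I_p -> int) (g : R) :
  homogz d g -> (forall a, dr a - dc a = d) -> hom_mx dr dc g%:M.
Proof.
move=> hg e a b; rewrite mxE; have [<-|_] := eqVneq a b.
  by rewrite e mulr1n.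
exact: homogz0.
Qed.

(** Write [(s)] for the ideal of the variables in [s], [I] for [J + y ^ w (s)],
    and [K] for the Koszul complex on [s]. The lift [phi : F -> K] of the
    projection [R/J -> R/(s)] restricts in positive steps to a lift of the
    inclusion of [J] into [(s)], whose cone [C] resolves [(s)/J]. The map [psi]
    lifts the multiplication by [y ^ w] from [(s)/J] to [R/J]; it is injective
    with cokernel [R/I]. Both cones are minimal, the first one because the
    Koszul complex is linear while [J] starts in degree 2. *)
Lemma splitting_res (J : R -> Prop) (s : seq 'I_n) (y : 'I_n) (w : nat) :
  graded_ideal J -> uniq s -> (0 < w)%N ->
  (forall p, J p -> mon_ideal (var_dvd s) p) ->
  (forall p, J p -> forall m, p@_m != 0 -> (1 < mdeg m)%N) ->
  (forall p, J (p * 'X_y ^+ w) -> J p) ->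
  exists F G : free_cplx n k, [/\ min_graded_free_res J F,
    min_graded_free_res (fun p => exists q r,
      [/\ J q, mon_ideal (var_dvd s) r & p = q + r * 'X_y ^+ w]) G
    & forall i j, count_deg G i.+2 j =
        (count_deg F i.+2 j + (count_deg (koszul k s) i.+2 (j - w%:Z)
         + count_deg F i.+1 (j - w%:Z)))%N].
Proof.
move=> gJ us w_gt0 Js J2 Jy.
have J0 p : J p -> p@_0%MM = 0.
  by move=> Jp; apply/eqP/negPn/negP => /(J2 _ Jp); rewrite mdeg0.
have [F [resF degF0 [eF aeF eaF]]] := min_res_exists gJ J0.
have ueF : unit_aug F eF by [].
set K := koszul k s.
have [eK ueK] : exists e, unit_aug K e := koszul_unit_aug k s.
have [aeK eaK] := ueK.
have gF := res_graded resF; have exF := res_exact resF.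
have minF := res_min resF.
have gK : graded_cplx K := @koszul_graded n k s.
have exK : exact_cplx K := @koszul_exact n k s us.
have minK : minimal_cplx K := @koszul_minimal n k s.
have degK i a : deg K i a = i%:Z := @koszul_deg n k s i a.
have homaF : hom_mx (deg F 0) (fun _ : 'I_1 => 0) (aug F).
  by move=> a b; rewrite ord1 subr0; apply: res_aug_homog resF _.
have homaK : hom_mx (deg K 0) (fun _ : 'I_1 => 0) (aug K).
  exact: koszul_aug_hom.
have homeF := unit_aug_hom homaF ueF; have homeK := unit_aug_hom homaK ueK.
have scal (u : 'rV[R]_1) : u = (u 0 0)%:M by rewrite -mx11_scalar.
pose phi0 := aug F *m eK.
have [||||||phi [ephi homphi phiS]] := @comparison _ _ F K phi0.
- exact: gF.
- exact: gK.
- exact: exK.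
- by move=> i; apply: exact_difM.
- exact: hom_mx_mul homaF homeK.
- move=> a; apply/(unit_aug_span _ ueK).
  rewrite row_mul -!mulmxA eaK mulmx1 [row a _ *m _]scal; apply/koszul_ideal/Js.
  by apply/(res_exact0 resF); apply: rowspan_row.
have phi0V : phi 0%N *m (aug K *m eF) = 1%:M.
  by rewrite ephi /phi0 mulmxA -[_ *m aug K]mulmxA eaK mulmx1.
have Vphi0 : (aug K *m eF) *m phi 0%N = 1%:M.
  by rewrite ephi /phi0 mulmxA -[_ *m aug F]mulmxA eaF mulmx1.
have phi_min i : cst (phi i.+1) = 0.
  apply/cst0P => a b; apply: homogz_cst0 (homphi _ a b) _.
  by rewrite degK; have := res_deg_gt resF ueF degF0 J2 a; lia.
(* The cone resolving (s)/J. *)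
pose C : free_cplx n k :=
  @cone n k (trunc_cplx F) (trunc_cplx K) (fun i => phi i.+1).
have gC : graded_cplx C.
  by apply: cone_graded => i; [apply: gF | apply: gK | apply: homphi].
have minC : minimal_cplx C.
  by apply: cone_minimal => i; [apply: minF | apply: minK | apply: phi_min].
have exC : exact_cplx C.
  apply: cone_exact => [i|i|i|v /= sv].
  - exact: exF.
  - exact: exK.
  - exact: phiS.
  apply/exF; have /exK := sv.
  rewrite -mulmxA phiS => /(congr1 (mulmx^~ (aug K *m eF))).
  by rewrite -!mulmxA phi0V mulmx1 mul0mx.
pose Y : R := 'X_y ^+ w.
have Y0 : Y@_0%MM = 0 by apply: homogz_cst0 (homogzXn y w) _; lia.
pose psi0 : 'M[R]_(rk K 1, rk F 0) := Y *: (dif K 0 *m (aug K *m eF)).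
(* Zero on the Koszul summand of the cone; the sign on the summand coming from F
   compensates the sign of the differential of the cone. *)
pose psi i : 'M[R]_(rk C i, rk F i) :=
  if i is i'.+1 then col_mx 0 ((-1) ^+ i' * Y)%:M else psi0.
have psiS i : psi i.+1 *m dif F i = dif C i *m psi i.
  rewrite mul_col_mx mul0mx mul_scalar_mx; case: i => [|i] /=.
    rewrite expr0 mul1r mul_col_mx -!scalemxAr !mulmxA exact_difM // !mul0mx.
    by rewrite scaler0 phiS -!mulmxA phi0V mulmx1.
  rewrite mul_block_col !mulmx0 !add0r mul0mx mul_mx_scalar scalerN -scaleNr.
  by rewrite exprS mulN1r mulNr.
have sign_cst i : ((-1) ^+ i * Y)@_0%MM = 0.
  by rewrite rmorphM /= Y0 mulr0.
(* The cone resolving R/I. *)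
pose G : free_cplx n k := @cone n k (shift_cplx w%:Z C) F psi.
have gG : graded_cplx G.
  apply: cone_graded => //; first exact: shift_graded.
  case=> [|i] /=.
    have homd : hom_mx (deg K 1) (deg F 0%N) (dif K 0 *m (aug K *m eF)).
      apply: hom_mx_mul (gK 0%N) _; exact: hom_mx_mul homaK homeF.
    move=> a b; rewrite mxE [_ - _](_ : _ = w%:Z + (deg K 1 a - deg F 0 b)).
      by apply: homogz_mul; [apply: homogzXn | apply: homd].
    by rewrite /=; lia.
  move=> a b; rewrite /sum_deg mxE; case: split => c.
    by rewrite mxE; apply: homogz0.
  apply: (homogz_scalar (d := w%:Z)
    (dr := fun c => deg F i.+1 c + w%:Z)) => [|d].
    by apply: homogz_sign; apply: homogzXn.
  by rewrite addrAC subrr add0r.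
have minG : minimal_cplx G.
  apply: cone_minimal => // -[|i] /=.
    apply/cst0P => a b; rewrite mxE.
    by rewrite rmorphM /= Y0 mul0r.
  rewrite /cst map_col_mx -!/(cst _) cst0 [cst _%:M](_ : _ = 0) ?col_mx0 //.
  apply/cst0P => a b; rewrite mxE.
  by case: eqP => _; rewrite ?mulr1n ?mulr0n ?mcoeff0.
have exG : exact_cplx G.
  apply: cone_exact => // v /= sv.
  have [u eu] : rowspan (dif F 0) (v *m (dif K 0 *m (aug K *m eF))).
    have /(res_exact0 resF) := sv.
    rewrite -scalemxAr -scalemxAl mxE mulrC => /Jy.
    by move/(res_exact0 resF).
  have /exK[t et] : (v - u *m phi 1%N) *m dif K 0 = 0.
    rewrite mulmxBl -[u *m _ *m _]mulmxA phiS mulmxA -eu.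
    by rewrite -!mulmxA [aug K *m (_ *m _)]mulmxA Vphi0 mulmx1 subrr.
  by exists (row_mx t u); rewrite mul_row_col -et subrK.
exists F, G; split=> //; last first.
  by move=> i j; rewrite count_cone count_shift count_cone.
have spanJ v : J ((v *m aug F) 0 0) <-> rowspan (dif F 0) v.
  exact: res_exact0 resF v.
split=> [a|i a b|p|v|i v|i].
- exact: res_aug_homog resF a.
- exact: gG.
- exists (p *: eF); rewrite -scalemxAl eaF !mxE mulr1 subrr.
  exists 0, 0; split; first exact: gideal0.
    exact: mon_ideal0.
  by rewrite mul0r addr0.
- have augG t' t : (row_mx t' t *m dif G 0) *m aug F
      = t' *m dif F 0 *m aug F + Y *: (t *m (dif K 0 *m aug K)).
    rewrite mul_row_col mulmxDl; congr (_ + _).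
    by rewrite -scalemxAr -scalemxAl -!mulmxA eaF mulmx1.
  split=> [[q [r [Jq sr e]]]|[u ->]].
    have [t et] : rowspan (dif K 0 *m aug K) r%:M by apply/koszul_ideal.
    have [t' et'] : rowspan (dif F 0) (q *: eF).
      by apply/spanJ; rewrite -scalemxAl eaF !mxE mulr1.
    exists (row_mx t' t).
    rewrite -[v]mulmx1 -[RHS]mulmx1 -aeF !(mulmxA _ (aug F)).
    congr (_ *m _); rewrite augG -et' -et -scalemxAl eaF [LHS]scal e.
    by rewrite scalemx1 scale_scalar_mx -raddfD mulrC.
  rewrite -[u]hsubmxK augG; set u1 := lsubmx u; set u2 := rsubmx u.
  exists ((u1 *m dif F 0 *m aug F) 0 0), ((u2 *m (dif K 0 *m aug K)) 0 0).
  split; first by apply/spanJ; exists u1.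
    by apply/koszul_ideal; exists u2; rewrite -scal.
  by rewrite !mxE mulrC.
- exact: exG.
- by apply/cst0P; apply: minG.
Qed.

End Splitting.

(** * Edge ideals *)

Section EdgeIdeals.
Variables (n : nat) (k : fieldType).
Local Notation R := {mpoly k[n]}.
Implicit Types D K : wograph n.

(** The generator of the edge ideal attached to the edge [e]. *)
Definition edge_mnm D (e : 'I_n * 'I_n) : 'X_{1..n} :=
  (U_(e.1) + U_(e.2) *+ wt D e.2)%MM.

(** Divisibility by some generator of the edge ideal. *)
Definition edge_dvd D : pred 'X_{1..n} :=
  fun m => [exists e, Defs.arc D e.1 e.2 && (edge_mnm D e <= m)%MM].

Lemma edge_dvdP D m :
  reflect (exists2 e, Defs.arc D e.1 e.2 & (edge_mnm D e <= m)%MM)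
    (edge_dvd D m).
Proof.
by apply: (iffP existsP) => [[e /andP[]]|[e De em]]; exists e => //; apply/andP.
Qed.

Lemma edge_dvd_up D : up_closed (edge_dvd D).
Proof.
move=> u m /edge_dvdP[e De em]; apply/edge_dvdP; exists e => //.
by apply: lepm_trans em _; apply: lem_addr.
Qed.

Lemma edge_ideal_mon D (p : R) :
  edge_ideal k D p <-> mon_ideal (edge_dvd D) p.
Proof.
have mnmE e : 'X_(e.1) * 'X_(e.2) ^+ wt D e.2 = 'X_[edge_mnm D e] :> R.
  by rewrite mpolyXn -mpolyXD.
split=> [[c ->]|Dp].
  apply: big_ind => [|q r|e De]; [exact: mon_ideal0 | exact: mon_idealD |].
  apply: mon_idealM; first exact: edge_dvd_up.
  rewrite mnmE -['X_[_]]scale1r; apply: mon_idealX.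
  by apply/edge_dvdP; exists e => //; apply: lepm_refl.
rewrite [p]mpolyE big_seq; apply: big_ind => [|q r [c1 ->] [c2 ->]|m].
- by exists (fun=> 0); rewrite big1 // => e _; rewrite mul0r.
- exists (fun e => c1 e + c2 e); rewrite -big_split.
  by apply: eq_bigr => e _; rewrite mulrDl.
rewrite mcoeff_msupp => /Dp /edge_dvdP[e De em].
exists (fun e' => if e' == e then p@_m *: 'X_[(m - edge_mnm D e)%MM] else 0).
rewrite (bigD1 e) //= eqxx mnmE -scalerAl -mpolyXD submK // big1 ?addr0 //.
by move=> e' /andP[_ /negPf ->]; rewrite mul0r.
Qed.

Lemma edge_ideal_graded D : graded_ideal (edge_ideal k D).
Proof.
have [I0 ID Ih] := @mon_ideal_graded n k _ (@edge_dvd_up D).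
split=> [|c p q|d p]; rewrite !edge_ideal_mon //; [exact: ID | exact: Ih].
Qed.

Lemma edge_ideal_deg D (p : R) : edge_ideal k D p ->
  forall m, p@_m != 0 -> (1 < mdeg m)%N.
Proof.
move/edge_ideal_mon => Dp m /Dp /edge_dvdP[e De em].
have /andP[_ /wt_gt0 w_gt0] := arc_vset De.
by rewrite -(submK em) mdegD mdegD mdeg1 mdegMn mdeg1; lia.
Qed.

Definition other_vars (x : 'I_n) := enum (predC1 x).

Lemma edge_ideal_del_vars K x (p : R) : edge_ideal k (del_vertex K x) p ->
  mon_ideal (var_dvd (other_vars x)) p.
Proof.
move/edge_ideal_mon; apply: mon_ideal_sub => m.
case/edge_dvdP=> e /= /and3P[_ ex _] em.
apply/hasP; exists e.1; first by rewrite mem_enum.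
apply: leq_trans (elimT mnm_lepP em e.1).
by rewrite mnmDE mnm1E eqxx.
Qed.

Lemma edge_ideal_del_nzd K x w (p : R) :
  edge_ideal k (del_vertex K x) (p * 'X_x ^+ w) ->
  edge_ideal k (del_vertex K x) p.
Proof.
rewrite !edge_ideal_mon mpolyXn; apply: mon_ideal_nzd => m.
case/edge_dvdP=> e /= De /mnm_lepP em; apply/edge_dvdP; exists e => //.
have /and3P[_ e1x e2x] := De.
apply/mnm_lepP => z; have := em z; rewrite !mnmDE !mulmnE !mnm1E.
have [<-|_] := eqVneq x z; last by rewrite mul0n addn0.
by rewrite (negPf e1x) (negPf e2x).
Qed.

(** The edges of a complete graph at a sink [x] contribute
    [x ^ w * (the other variables)]. *)
Lemma edge_ideal_sink K x (p : R) :
  vset K = [set: 'I_n] -> is_complete K -> is_sink K x ->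
  edge_ideal k K p <-> exists q r, [/\ edge_ideal k (del_vertex K x) q,
    mon_ideal (var_dvd (other_vars x)) r & p = q + r * 'X_x ^+ wt K x].
Proof.
move=> vK cK [_ sinkx]; rewrite edge_ideal_mon mpolyXn; split.
  case/(@mon_ideal_split _ _ _ (edge_dvd (del_vertex K x))
      (var_dvd (other_vars x)) (U_(x) *+ wt K x)) => [m|q [r [Jq sr ->]]].
    case/edge_dvdP=> e De em.
    have e1x : e.1 != x by apply: contraTneq De => ->; apply: sinkx.
    have [e2x|e2x] := eqVneq e.2 x; last first.
      by apply/orP; left; apply/edge_dvdP; exists e => //=; apply/and3P.
    apply/orP; right; rewrite /edge_mnm e2x in em.
    have le_xm : (U_(x) *+ wt K x <= m)%MM.
      by apply: lepm_trans em; rewrite addmC; apply: lem_addr.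
    rewrite le_xm; apply/hasP; exists e.1; first by rewrite mem_enum.
    have := elimT mnm_lepP em e.1; rewrite mnmBE !mnmDE !mulmnE !mnm1E eqxx.
    by rewrite eq_sym (negPf e1x) mul0n subn0 addn0.
  by exists q, r; split=> //; apply/edge_ideal_mon.
case=> q [r [/edge_ideal_mon Jq sr ->]]; apply: mon_idealD.
  apply: mon_ideal_sub Jq => m /edge_dvdP[e /= /and3P[De _ _] em].
  by apply/edge_dvdP; exists e.
move=> m rm.
have : m \in msupp (r * 'X_[(U_(x) *+ wt K x)%MM]) by rewrite mcoeff_msupp.
move/msuppM_le/allpairsP => [[m1 m2] /=]; rewrite msuppX inE mcoeff_msupp.
case=> /sr /hasP[z]; rewrite mem_enum inE => zx m1z /eqP -> ->.
apply/edge_dvdP; exists (z, x) => /=.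
  have := cK z x; rewrite vK !in_setT (negPf (sinkx z)) orbF; exact.
rewrite /edge_mnm /=; apply/mnm_lepP => t; rewrite !mnmDE leq_add2r mnm1E.
by have [<-|] := eqVneq z t.
Qed.

Lemma min_res_ext (I I' : R -> Prop) F : (forall p, I p <-> I' p) ->
  min_graded_free_res I F -> min_graded_free_res I' F.
Proof.
move=> eI [h1 h2 h3 h4 h5 h6]; split=> // [p|v].
  by have [v Iv] := h3 p; exists v; apply/eI.
by rewrite -eI.
Qed.

Lemma count_koszul s i j :
  count_deg (koszul k s) i j =
    if j == i%:Z then 'C(size (s : seq 'I_n), i) else 0%N.
Proof.
rewrite /count_deg (eq_card (B := [pred _ | j == i%:Z])) => [|a]; last first.
  by rewrite !inE koszul_deg eq_sym.
case: ifP => _; last exact: card0.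
by rewrite -(koszul_rk k s i) -[RHS]card_ord.
Qed.

End EdgeIdeals.

Theorem theorem5p4 (k : fieldType) (n : nat) (hn : (3 <= n)%N)
    (K : wograph n)
    (hvset : vset K = [set: 'I_n])
    (hcomplete : is_complete K)
    (hsource : forall x, is_source K x -> wt K x = 1%N)
    (hweight : exists p, (1 < wt K p)%N)
    (xn : 'I_n) (hxn : nat_of_ord xn = n.-1)
    (hsink : is_sink K xn)
    (i : nat) (j : int) (hi : (1 < i)%N) :
  betti (edge_ideal k K) i j =
    if j == i%:Z + (wt K xn)%:Z then
      (betti (edge_ideal k (del_vertex K xn)) i j + 'C(n.-1, i)
       + betti (edge_ideal k (del_vertex K xn)) i.-1 (j - (wt K xn)%:Z))%N
    else
      (betti (edge_ideal k (del_vertex K xn)) i j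
       + betti (edge_ideal k (del_vertex K xn)) i.-1 (j - (wt K xn)%:Z))%N.
Proof.
have w_gt0 : (0 < wt K xn)%N by apply: wt_gt0; have [] := hsink.
have gJ := edge_ideal_graded k (del_vertex K xn).
have [F [G [resF resG countG]]] :=
  splitting_res gJ (enum_uniq (predC1 xn)) w_gt0
  (@edge_ideal_del_vars _ _ K xn) (@edge_ideal_deg _ _ (del_vertex K xn))
  (@edge_ideal_del_nzd _ _ K xn (wt K xn)).
have {}resG : min_graded_free_res (edge_ideal k K) G.
  apply: min_res_ext resG => p; apply: iff_sym.
  exact: edge_ideal_sink hvset hcomplete hsink.
case: i hi => [|[|i]] // _; rewrite (bettiE _ _ (edge_ideal_graded k K) resG).
rewrite (bettiE i.+2 _ gJ resF) (bettiE i.+1 _ gJ resF) -!/(count_deg _ _ _).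
rewrite countG count_koszul.
rewrite -cardE cardC1 card_ord -[X in _ == X](addrK (wt K xn)%:Z).
rewrite (can_eq (subrK _)) /=.
by case: ifP => _; rewrite ?addnA.
Qed.
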